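(* Let $\mathcal{P}$ be a grid polyomino. List the facets of $\Delta_{\mathcal{P}}$ as $F_0,F_1,\dots,F_s$ with $F_{i+1}<_{\mathrm{lex}}F_i$ for all $i$. Then both of the following hold. (1) For every $j\in[s]$, $$\langle F_0,\dots,F_{j-1}\rangle\cap\langle F_j\rangle=\big\langle\{F_j\setminus\{v\}: v \text{ is the lower right corner of a generalized step of } F_j\}\big\rangle.$$ (2) $F_0,F_1,\dots,F_s$ is a shelling order of $\Delta_{\mathcal{P}}$.
   Context: Grid polyomino: take $I=[(1,1),(m,n)]$ and intervals $H_{ij}=[a_{ij},b_{ij}]$ for $i\in[r]$, $j\in[s]$, with $1<(a_{ij})_1<(b_{ij})_1<m$ and $1<(a_{ij})_2<(b_{ij})_2<n$. Assume the first coordinates of $a_{ij}$ and $b_{ij}$ depend only on $i$, the second coordinates depend only on $j$, $(a_{i+1,j})_1=(b_{ij})_1+1$, and $(a_{i,j+1})_2=(b_{ij})_2+1$. Then $\mathcal{P}$ is the set of unit cells $[v,v+(1,1)]$ in $I$ not contained in any $H_{ij}$. $V(\mathcal{P})$ is its set of vertices. An inner interval of $\mathcal{P}$ is a proper interval $[u,w]$ whose unit cells all lie in $\mathcal{P}$; its anti-diagonal corners are $(u_1,w_2)$ and $(w_1,u_2)$. $\Delta_{\mathcal{P}}$ is the simplicial complex on $V(\mathcal{P})$ whose Stanley–Reisner ideal is the initial ideal of the polyomino ideal $I_{\mathcal{P}}$, taken in the reverse lexicographic order with $x_{(i,j)}>x_{(k,l)}$ if $j>l$, or if $j=l$ and $i>k$.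 Equivalently, its faces are the subsets of $V(\mathcal{P})$ containing no two vertices that are the anti-diagonal corners of an inner interval of $\mathcal{P}$. It is a pure complex. $\langle G_1,\dots,G_t\rangle$ denotes the simplicial complex generated by the sets $G_1,\dots,G_t$. A subset $F'=\{(a,b),(c,d),(e,f)\}$ of a face $F$ is a generalized step of $F$, with lower right corner $(c,d)$, if all of the following hold: - $b=d$, $c=e$, $a<c$ and $d<f$; - no vertex $(t,b)$ with $a<t<c$ lies in $F$; - no vertex $(c,t)$ with $d<t<f$ lies in $F$; - $(c,d)$ is the lower right corner of a cell of $\mathcal{P}$; - $[(a,b),(e,f)]$ is an inner interval of $\mathcal{P}$. Total order on $V(\mathcal{P})$: for $a=(i,j)$ and $b=(k,l)$, set $b<_V a$ if $j>l$, or if $j=l$ and $i>k$. Write each facet as $F=\{a_1,\dots,a_d\}$ with $a_{t+1}<_V a_t$. For two facets $F=\{a_1,\dots,a_d\}$ and $G=\{b_1,\dots,b_d\}$, let $k$ be the least index with $a_k\ne b_k$; then $F<_{\mathrm{lex}}G$ if $a_k<_V b_k$. A shelling order of a pure complex is an ordering $F_0,\dots,F_s$ of its facets such that, for each $j\ge1$, $\langle F_0,\dots,F_{j-1}\rangle\cap\langle F_j\rangle$ is generated by a nonempty set of maximal proper faces of $F_j$. *)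

(* Defs.v *)
From mathcomp Require Import all_boot.
Set Implicit Arguments. Unset Strict Implicit. Unset Printing Implicit Defensive.

(* Data of a grid polyomino: I = [(1,1),(m,n)], hole H_ij = [a_ij, b_ij] with
   (a_ij)_1 = xa i, (b_ij)_1 = xb i, (a_ij)_2 = ya j, (b_ij)_2 = yb j,
   for 0-based indices i < r, j < s (i.e. i+1 in [r], j+1 in [s]). *)
Record grid := Grid {
  gm : nat; gn : nat; gr : nat; gs : nat;
  gxa : nat -> nat; gxb : nat -> nat; gya : nat -> nat; gyb : nat -> nat }.

Definition grid_ok (G : grid) : Prop :=
  0 < gr G /\ 0 < gs G /\
  (forall i, i < gr G -> 1 < gxa G i /\ gxa G i < gxb G i /\ gxb G i < gm G) /\
  (forall i, i.+1 < gr G -> gxa G i.+1 = (gxb G i).+1) /\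
  (forall j, j < gs G -> 1 < gya G j /\ gya G j < gyb G j /\ gyb G j < gn G) /\
  (forall j, j.+1 < gs G -> gya G j.+1 = (gyb G j).+1).

Definition in_hole (G : grid) (x y : nat) : bool :=
  [exists i : 'I_(gr G), exists j : 'I_(gs G),
     (gxa G i <= x) && (x.+1 <= gxb G i) && (gya G j <= y) && (y.+1 <= gyb G j)].

(* the unit cell with lower left corner (x,y) belongs to P *)
Definition cellP (G : grid) (x y : nat) : bool :=
  (1 <= x) && (x < gm G) && (1 <= y) && (y < gn G) && ~~ in_hole G x y.

(* lattice points of I (coordinates 0..m, 0..n; V(P) lies inside) *)
Definition vtx (G : grid) : finType := ('I_(gm G).+1 * 'I_(gn G).+1)%type.
Definition vx (G : grid) (v : vtx G) : nat := v.1.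
Definition vy (G : grid) (v : vtx G) : nat := v.2.
Definition v0 (G : grid) : vtx G := (ord0, ord0).

Definition VP (G : grid) : {set vtx G} :=
  [set v : vtx G | [exists dx : bool, exists dy : bool,
     (dx <= vx v) && (dy <= vy v) && cellP G (vx v - dx) (vy v - dy)]].

Definition inner (G : grid) (u1 u2 w1 w2 : nat) : Prop :=
  u1 < w1 /\ u2 < w2 /\
  forall x y, u1 <= x < w1 -> u2 <= y < w2 -> cellP G x y.

Definition antidiag (G : grid) (a b : vtx G) : Prop :=
  exists u1 u2 w1 w2, inner G u1 u2 w1 w2 /\
    vx a = u1 /\ vy a = w2 /\ vx b = w1 /\ vy b = u2.

Definition is_face (G : grid) (F : {set vtx G}) : Prop :=
  F \subset VP G /\ forall a b, a \in F -> b \in F -> ~ antidiag a b.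

Definition is_facet (G : grid) (F : {set vtx G}) : Prop :=
  is_face F /\ forall H, is_face H -> F \subset H -> H = F.

Definition ltV (G : grid) (b a : vtx G) : bool :=
  (vy b < vy a) || ((vy b == vy a) && (vx b < vx a)).
Definition leV (G : grid) (b a : vtx G) : bool := ltV b a || (b == a).

Definition seqV (G : grid) (F : {set vtx G}) : seq (vtx G) :=
  sort (fun x y => leV y x) (enum F).

Definition lexlt (G : grid) (F H : {set vtx G}) : Prop :=
  exists k, k < size (seqV F) /\ k < size (seqV H) /\
    (forall t, t < k -> nth (v0 G) (seqV F) t = nth (v0 G) (seqV H) t) /\
    ltV (nth (v0 G) (seqV F) k) (nth (v0 G) (seqV H) k).

Definition gen_step_lrc (G : grid) (F : {set vtx G}) (c : vtx G) : Prop :=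
  exists A E : vtx G,
    [/\ A \in F, c \in F & E \in F] /\
    vy A = vy c /\ vx c = vx E /\ vx A < vx c /\ vy c < vy E /\
    (forall t : vtx G, vy t = vy A -> vx A < vx t < vx c -> t \notin F) /\
    (forall t : vtx G, vx t = vx c -> vy c < vy t < vy E -> t \notin F) /\
    (exists x, x.+1 = vx c /\ cellP G x (vy c)) /\
    inner G (vx A) (vy A) (vx E) (vy E).

Definition gen (T : finType) (gens : {set T} -> Prop) : {set T} -> Prop :=
  fun K => exists2 H, gens H & K \subset H.

Definition prefix_cap (T : finType) (fs : seq {set T}) (j : nat) : {set T} -> Prop :=
  fun K => gen (fun H => exists2 i, i < j & H = nth set0 fs i) K /\
           gen (fun H => H = nth set0 fs j) K.

Definition max_proper_face (T : finType) (F H : {set T}) : Prop :=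
  H \proper F /\ forall K, H \subset K -> K \proper F -> K = H.

Definition is_shelling (T : finType) (facet : {set T} -> Prop) (fs : seq {set T}) : Prop :=
  uniq fs /\ (forall F, facet F <-> F \in fs) /\
  forall j, 1 <= j < size fs ->
    exists Gs : {set {set T}},
      Gs != set0 /\ (forall H, H \in Gs -> max_proper_face (nth set0 fs j) H) /\
      forall K, prefix_cap fs j K <-> gen (fun H => H \in Gs) K.

(* Main.v *)
(** Let w be the upper left corner of a generalized step of a face F with lower
    right corner v.  Then F \ v + w is again a face: a vertex of F \ v in
    conflict with w lies in conflict with one of the three vertices of the step.
    The only delicate case is that of a vertex p to the upper left of w, where
    the lack of conflict of p with the two other vertices of the step puts a
    hole to the left of the step and a hole above it; since the set of holes is
    a product, there would then be a hole inside the step.  As w > v, any facet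
    containing F \ v + w precedes F.

    Conversely, let the facet H precede F, and let z be the largest vertex of
    their symmetric difference, so that z lies in H.  The conflicts of z with F
    all lie to the lower right of z, because F and H agree above z.  Among them
    let v have the largest abscissa and then the smallest ordinate.  Maximality
    of F yields vertices of F above v and to the left of v inside the inner
    interval spanned by z and v, so v is the corner of a generalized step, and
    v is not in H because it is in conflict with z. *)
Require Import Defs.
From mathcomp Require Import all_boot.
From mathcomp Require Import boolp zify.
Set Implicit Arguments. Unset Strict Implicit. Unset Printing Implicit Defensive.

Lemma ex_argmax (T : finType) (P : T -> Prop) (f : T -> nat) :
  (exists v, P v) -> exists2 v, P v & forall w, P w -> f w <= f v.
Proof.
case=> v0 Pv0; have Pv0' : `[<P v0>] by apply/asboolP.
case: (@arg_maxnP _ v0 (fun v => `[<P v>]) f Pv0') => v /asboolP Pv max_v.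
by exists v => // w Pw; apply: max_v; apply/asboolP.
Qed.

Lemma ex_argmin (T : finType) (P : T -> Prop) (f : T -> nat) :
  (exists v, P v) -> exists2 v, P v & forall w, P w -> f v <= f w.
Proof.
case=> v0 Pv0; have Pv0' : `[<P v0>] by apply/asboolP.
case: (@arg_minnP _ v0 (fun v => `[<P v>]) f Pv0') => v /asboolP Pv min_v.
by exists v => // w Pw; apply: min_v; apply/asboolP.
Qed.

(** * Cells, holes and corners *)

Lemma in_holeP (G : grid) (x y : nat) :
  in_hole G x y <->
  (exists i : 'I_(gr G), gxa G i <= x < gxb G i) /\
  (exists j : 'I_(gs G), gya G j <= y < gyb G j).
Proof.
split=> [/existsP[i /existsP[j /andP[/andP[/andP[h1 h2] h3] h4]]]|].
  by split; [exists i; rewrite h1 h2 | exists j; rewrite h3 h4].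
case=> -[i /andP[h1 h2]] [j /andP[h3 h4]].
by apply/existsP; exists i; apply/existsP; exists j; rewrite h1 h2 h3 h4.
Qed.

(** Holes form a product: if [(x1, y1)] and [(x2, y2)] both lay in holes, the column of the first
    and the row of the second would put [(x1, y2)] in a hole. *)
Lemma cellP_exchange (G : grid) (x1 x2 y1 y2 : nat) :
  cellP G x1 y2 -> cellP G x2 y1 -> cellP G x1 y1 \/ cellP G x2 y2.
Proof.
rewrite /cellP => /andP[/andP[/andP[/andP[-> ->] a3] a4] a5].
move=> /andP[/andP[/andP[/andP[-> ->] b3] b4] b5].
rewrite a3 a4 b3 b4 /=.
case: (boolP (in_hole G x1 y1)) => /= [/in_holeP[h1 _]|]; last by left.
case: (boolP (in_hole G x2 y2)) => /= [/in_holeP[_ h2]|]; last by right.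
by case/negP: a5; apply/in_holeP.
Qed.

Lemma antidiagP (G : grid) (a b : vtx G) :
  antidiag a b <-> inner G (vx a) (vy b) (vx b) (vy a).
Proof.
split=> [[u1 [u2 [w1 [w2 [h [-> [-> [-> ->]]]]]]]] //|h].
by exists (vx a), (vy b), (vx b), (vy a).
Qed.

Lemma VP_corner (G : grid) (u : vtx G) (x y : nat) :
  cellP G x y -> x <= vx u <= x.+1 -> y <= vy u <= y.+1 -> u \in VP G.
Proof.
move=> cxy hx hy; rewrite inE; apply/existsP; exists (vx u != x).
apply/existsP; exists (vy u != y).
have -> : vx u - (vx u != x) = x by case: eqP; lia.
have -> : vy u - (vy u != y) = y by case: eqP; lia.
by rewrite cxy andbT; do 2 case: eqP; lia.
Qed.

(** * Faces and facets *)

Lemma face_sub (G : grid) (F : {set vtx G}) (H : {set vtx G}) :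
  is_face F -> H \subset F -> is_face H.
Proof.
case=> FV Fn HF; split=> [|a b aH bH]; first exact: subset_trans HF FV.
by apply: Fn; apply: (subsetP HF).
Qed.

Lemma face_setU1 (G : grid) (F : {set vtx G}) (w : vtx G) :
  is_face F -> w \in VP G ->
  (forall p, p \in F -> ~ antidiag p w /\ ~ antidiag w p) -> is_face (w |: F).
Proof.
case=> FV Fn wV wF; split=> [|a b]; first by rewrite subUset sub1set wV.
rewrite !inE => /orP[/eqP->|aF] /orP[/eqP->|bF]; last exact: Fn.
- by move=> /antidiagP[]; lia.
- by case: (wF _ bF).
- by case: (wF _ aF).
Qed.

Lemma facet_conflict (G : grid) (F : {set vtx G}) (w : vtx G) :
  is_facet F -> w \in VP G -> w \notin F ->
  exists2 p, p \in F & antidiag p w \/ antidiag w p.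
Proof.
move=> [Ff Fmax] wV wF; apply: contrapT => nex.
have /Fmax /(_ (subsetUr _ _)) Fw : is_face (w |: F).
  apply: face_setU1 => // p pF.
  by split=> h; apply: nex; exists p => //; [left | right].
by rewrite -Fw setU11 in wF.
Qed.

Lemma face_in_facet (G : grid) (F : {set vtx G}) :
  is_face F -> exists2 H, is_facet H & F \subset H.
Proof.
move=> Ff; have Ff' : `[<is_face F>] by apply/asboolP.
have [H /maxsetP[/asboolP Hf Hmax] FH] :=
  @maxset_exists _ (fun F : {set vtx G} => `[<is_face F>]) _ Ff'.
by exists H => //; split=> // K /asboolP Kf; apply: Hmax.
Qed.

(** * The lexicographic order *)

Lemma mem_seqV (G : grid) (F : {set vtx G}) : seqV F =i F.
Proof. by move=> v; rewrite mem_sort mem_enum. Qed.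

Lemma ltV_nth_seqV (G : grid) (F : {set vtx G}) (t k : nat) :
  t < size (seqV F) -> k < size (seqV F) ->
  ltV (nth (v0 G) (seqV F) k) (nth (v0 G) (seqV F) t) -> t < k.
Proof.
move=> ht hk lt_kt; rewrite ltnNge; apply/negP => le_kt.
have leV_vxy (a b : vtx G) : leV a b = (vy a < vy b) || (vy a == vy b) && (vx a <= vx b).
  rewrite /leV /ltV (_ : (a == b) = (vx a == vx b) && (vy a == vy b)); first lia.
  by case: a b => [a1 a2] [b1 b2].
have tot : total (fun x y : vtx G => leV y x) by move=> a b; rewrite !leV_vxy; lia.
have tr : transitive (fun x y : vtx G => leV y x).
  by move=> b a c; rewrite !leV_vxy; lia.
have rf : reflexive (fun x y : vtx G => leV y x) by move=> a; rewrite leV_vxy; lia.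
have := sorted_leq_nth tr rf (v0 G) (sort_sorted tot (enum F)) k t hk ht le_kt.
by move: lt_kt; rewrite leV_vxy /ltV /seqV; lia.
Qed.

(** The lists decrease, so points above the first disagreement occur at earlier indices, where the
    lists coincide. *)
Lemma lexlt_witness (G : grid) (F H : {set vtx G}) :
  lexlt F H ->
  exists z, [/\ z \in H, z \notin F & forall y, ltV z y -> (y \in F) = (y \in H)].
Proof.
move=> [k [kF [kH [eqk ltk]]]].
have uH : uniq (seqV H) by rewrite sort_uniq enum_uniq.
have ltV_trans (a b c : vtx G) : ltV a b -> ltV b c -> ltV a c.
  by rewrite /ltV; lia.
set z := nth (v0 G) (seqV H) k in ltk.
(* The bound is the entry of [F], not [z], so that [y = z] is allowed; this yields [z \notin F]. *)
have inF y : ltV (nth (v0 G) (seqV F) k) y -> y \in F ->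
    exists t, [/\ t < k, t < size (seqV H) & nth (v0 G) (seqV H) t = y].
  move=> lty; rewrite -mem_seqV => /(nthP (v0 G))[t ht ety].
  have tk : t < k by apply: (@ltV_nth_seqV _ F) => //; rewrite ety.
  by exists t; rewrite -eqk //; split=> //; apply: ltn_trans kH.
exists z; split=> [||y zy]; first by rewrite -mem_seqV mem_nth.
  apply/negP => /(inF _ ltk)[t [tk tH /eqP]].
  by rewrite nth_uniq // => /eqP tk'; rewrite tk' ltnn in tk.
apply/idP/idP => [/inF|].
  by case=> [|t [_ tH <-]]; [apply: ltV_trans zy | rewrite -mem_seqV mem_nth].
rewrite -mem_seqV => /(nthP (v0 G))[t ht ety].
have tk : t < k by apply: (@ltV_nth_seqV _ H) => //; rewrite ety.
by rewrite -ety -eqk // -mem_seqV mem_nth // (ltn_trans tk).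
Qed.

Lemma lexlt_irr (G : grid) (F : {set vtx G}) : ~ lexlt F F.
Proof. by move=> /lexlt_witness[z [-> ]]. Qed.

Lemma lexlt_trans (G : grid) (F H K : {set vtx G}) :
  lexlt F H -> lexlt H K -> lexlt F K.
Proof.
move=> [k [kF [kH [eqk ltk]]]] [l [lH [lK [eql ltl]]]].
case: (ltngtP k l) => kl.
- exists k; split=> //; split; first exact: ltn_trans lK.
  split=> [t tk|]; last by rewrite -eql.
  by rewrite -eql ?eqk // (ltn_trans tk).
- exists l; split; first exact: ltn_trans kF.
  split=> //; split=> [t tl|]; last by rewrite eqk.
  by rewrite eqk ?eql // (ltn_trans tl).
- subst l; exists k; do 3?split=> //; first by move=> t tk; rewrite eqk ?eql.
  by move: ltk ltl; rewrite /ltV; lia.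
Qed.

Lemma lexlt_nth (G : grid) (fs : seq {set vtx G}) :
  (forall i, i.+1 < size fs -> lexlt (nth set0 fs i.+1) (nth set0 fs i)) ->
  forall i j, i < j < size fs -> lexlt (nth set0 fs j) (nth set0 fs i).
Proof.
move=> dec i j /andP[]; elim: j => // j IHj; rewrite ltnS leq_eqVlt.
case/orP=> [/eqP-> | ij] hj; first exact: dec.
by apply: lexlt_trans (dec _ hj) _; apply: IHj => //; apply: ltnW.
Qed.

(** * From a generalized step to an exchange *)

Lemma gen_step_exchange (G : grid) (F : {set vtx G}) (v : vtx G) :
  is_face F -> gen_step_lrc F v ->
  exists w, [/\ is_face (w |: F :\ v), ltV v w & antidiag w v].
Proof.
move=> Ff [A [E [[AF vF EF] [ey [ex [ltx [lty [nox [noy [_ In]]]]]]]]]].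
have [FV Fn] := Ff; have [_ [_ B1]] := In.
exists (A.1, E.2); have [wx wy] : vx (A.1, E.2) = vx A /\ vy (A.1, E.2) = vy E by [].
move: (A.1, E.2) wx wy => w wx wy.
split; last 2 first.
- by rewrite /ltV wy lty.
- by apply/antidiagP; rewrite wx wy ex -ey.
apply: face_setU1; first exact: face_sub Ff (subsetDl _ _).
  by apply: (@VP_corner _ _ (vx A) (vy E).-1); [apply: B1 | |]; lia.
move=> p; rewrite !inE => /andP[pv pF]; split=> /antidiagP[].
  rewrite wx wy => p1 [p2 B2].
  have [x1 [y1 [hx1 hy1 n1]]] : exists x y,
      [/\ vx A <= x < vx v, vy E <= y < vy p & ~ cellP G x y].
    apply: contrapT => nex; case: (Fn p E pF EF); apply/antidiagP.
    split; [lia | split; first lia]; move=> x y hx hy.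
    case: (ltnP x (vx A)) => xA; first by apply: B2; lia.
    by apply: contrapT => nc; apply: nex; exists x, y; split=> //; lia.
  have [x2 [y2 [hx2 hy2 n2]]] : exists x y,
      [/\ vx p <= x < vx A, vy A <= y < vy E & ~ cellP G x y].
    apply: contrapT => nex; case: (Fn p A pF AF); apply/antidiagP.
    split; [lia | split; first lia]; move=> x y hx hy.
    case: (leqP (vy E) y) => yE; first by apply: B2; lia.
    by apply: contrapT => nc; apply: nex; exists x, y; split=> //; lia.
  (* The first cell lies in the step, the second in the interval spanned by [p] and [w]; the missing
     cells lie above the step and to its left. *)
  have c12 : cellP G x1 y2 by apply: B1; lia.
  have c21 : cellP G x2 y1 by apply: B2; lia.
  by case: (cellP_exchange c12 c21).
rewrite wx wy => p1 [p2 B2].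
(* Now [p] is to the lower right of [w]. Right of [v] it conflicts with [E], below [v] with [A], and
   strictly inside the step with [v]; the bottom and right sides are excluded by [nox] and [noy]. *)
case: (ltnP (vx v) (vx p)) => hx.
  apply: (Fn E p EF pF); apply/antidiagP; split; [lia | split; first lia].
  by move=> x y ? ?; apply: B2; lia.
case: (ltnP (vy p) (vy v)) => hy.
  apply: (Fn A p AF pF); apply/antidiagP; split; [lia | split; first lia].
  by move=> x y ? ?; apply: B2; lia.
case: (ltngtP (vx p) (vx v)) => hx'; last first.
- case: (ltngtP (vy p) (vy v)) => hy'; first lia.
    by have/negP := noy p hx' ltac:(lia).
  case/eqP: pv; apply/eqP; rewrite -pair_eqE; apply/andP.
  by split; apply/eqP; apply: val_inj.
- lia.
case: (ltngtP (vy p) (vy v)) => hy'; first lia.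
  apply: (Fn p v pF vF); apply/antidiagP; split; [lia | split; first lia].
  by move=> x y ? ?; apply: B1; lia.
by have/negP := nox p ltac:(lia) ltac:(lia).
Qed.

(** * From a preceding facet to a generalized step *)

Section ConflictCorner.

Variables (G : grid) (F H : {set vtx G}) (z v : vtx G).
Hypotheses (Ffacet : is_facet F) (Hface : is_face H) (zH : z \in H).
Hypothesis eq_above : forall y, ltV z y -> (y \in F) = (y \in H).
Hypotheses (vF : v \in F) (zv : antidiag z v).
Hypothesis v_right : forall p, p \in F -> antidiag z p -> vx p <= vx v.
Hypothesis v_low :
  forall p, p \in F -> antidiag z p -> vx p = vx v -> vy v <= vy p.

Lemma facet_antidiag_free : forall a b, a \in F -> b \in F -> ~ antidiag a b.
Proof. by case: Ffacet => -[]. Qed.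

(** Such a [p] is above [z] in the order, hence belongs to [H] together with [z]. *)
Lemma no_conflict_above p : p \in F -> vx p < vx z -> vy z < vy p ->
  ~ (forall x y, vx p <= x < vx z -> vy z <= y < vy p -> cellP G x y).
Proof.
move=> pF px py B; case: Hface => _ /(_ p z); apply=> //; last by apply/antidiagP.
by rewrite -eq_above // /ltV py.
Qed.

(** If the upper right corner of the interval of [z] and [v] were not in [F], a point of [F] in
    conflict with it would conflict with [v], or lie to the upper left of [z], or be a conflict of
    [z] further right than [v]. *)
Lemma above_corner :
  exists E, [/\ E \in F, vx E = vx v & vy v < vy E <= vy z].
Proof.
have /antidiagP[zvx [zvy B]] := zv.
case: (boolP ((v.1, z.2) \in F)) => [eF|].
  by exists (v.1, z.2); split=> //; apply/andP; split.
have [ex ey] : vx (v.1, z.2) = vx v /\ vy (v.1, z.2) = vy z by [].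
move: (v.1, z.2) ex ey => e ex ey eF.
have eV : e \in VP G.
  by apply: (@VP_corner _ _ (vx v).-1 (vy z).-1); [apply: B | |]; lia.
have [q qF] := facet_conflict Ffacet eV eF.
case=> /antidiagP; rewrite ex ey => -[qx [qy B']]; exfalso.
  case: (ltnP (vx q) (vx z)) => qz.
    by apply: (no_conflict_above qF) => // x y ? ?; apply: B'; lia.
  apply: (facet_antidiag_free qF vF); apply/antidiagP; split=> //; split; first lia.
  move=> x y ? ?.
  by case: (leqP (vy z) y) => ?; [apply: B' | apply: B]; lia.
case: (ltnP (vy q) (vy v)) => qv.
  apply: (facet_antidiag_free vF qF); apply/antidiagP; split=> //; split=> //.
  by move=> x y ? ?; apply: B'; lia.
suff /(v_right qF) : antidiag z q by lia.
apply/antidiagP; split; [lia | split=> // x y ? ?].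
by case: (leqP (vx v) x) => ?; [apply: B' | apply: B]; lia.
Qed.

(* The point q is the rightmost conflict of z to the left of the column of v;
   maximality of F is applied to its projection to the row of v, or to the
   projection of z when there is no such q. *)
Lemma left_corner :
  exists A, [/\ A \in F, vy A = vy v & vx z <= vx A < vx v].
Proof.
have /antidiagP[zvx [zvy B]] := zv.
pose C q := [/\ q \in F, antidiag z q & vx q < vx v].
have proj (u e : vtx G) :
    (u = z /\ ~ exists q, C q) \/ [/\ C u, (forall q, C q -> vx q <= vx u) & vy u < vy v] ->
    vx e = vx u -> vy e = vy v -> e \in F.
  move=> hu ex ey; apply: contrapT => /negP eF.
  have ux : vx z <= vx u < vx v.
    by case: hu => [[-> _]|[[_ /antidiagP[? _] ?] _ _]]; lia.
  have eV : e \in VP G.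
    by apply: (@VP_corner _ _ (vx u) (vy v)); [apply: B | |]; lia.
  have [q qF] := facet_conflict Ffacet eV eF.
  case=> /antidiagP; rewrite ex ey => -[qx [qy B']].
    case: (ltnP (vy z) (vy q)) => qz.
      case: (ltnP (vx q) (vx z)) => qz'.
        by apply: (no_conflict_above qF) => // x y ? ?; apply: B'; lia.
      case: hu => [[uz _] | [[uF /antidiagP[_ [_ Bu]] _] _ uv]]; first by subst u; lia.
      apply: (facet_antidiag_free qF uF); apply/antidiagP; split=> //; split; first lia.
      move=> x y ? ?.
      by case: (leqP (vy v) y) => ?; [apply: B' | apply: Bu]; lia.
    apply: (facet_antidiag_free qF vF); apply/antidiagP; split; [lia | split=> // x y ? ?].
    by case: (ltnP x (vx u)) => ?; [apply: B' | apply: B]; lia.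
  case: (ltnP (vx v) (vx q)) => qv.
    apply: (facet_antidiag_free vF qF); apply/antidiagP; split=> //; split=> // x y ? ?.
    by apply: B'; lia.
  (* Three intervals cover the one of [z] and [q]: that of [z] and [v] in the rows from [v] up, that
     of [e] and [q] in the columns from [u] on, and that of [z] and [u] for the rest. For the last,
     [q] is not below [u], since it would conflict with [u]. *)
  have zq : antidiag z q.
    apply/antidiagP; split; [lia | split; [lia | move=> x y ? ?]].
    case: (leqP (vy v) y) => yv; first by apply: B; lia.
    case: (leqP (vx u) x) => xu; first by apply: B'; lia.
    case: hu => [[uz _] | [[uF /antidiagP[_ [_ Bu]] _] _ uv]]; first by subst u; lia.
    apply: Bu; first lia.
    case: (ltnP (vy q) (vy u)) => qu; last by lia.
    case: (facet_antidiag_free uF qF); apply/antidiagP; split=> //; split=> // x' y' ? ?.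
    by apply: B'; lia.
  have qlt : vx q < vx v.
    by rewrite ltn_neqAle qv andbT; apply/eqP => /(v_low qF zq); lia.
  case: hu => [[_ noC] | [_ umax _]]; last first.
    by have := umax q (And3 qF zq qlt); lia.
  by apply: noC; exists q.
have [exC | noC] := pselect (exists q, C q); last first.
  exists (z.1, v.2); split=> //; last by apply/andP; split.
  by apply: (proj z); first left.
have [q Cq qmax] := ex_argmax (fun q : vtx G => vx q) exC.
have [qF /antidiagP[zqx [zqy Bq]] qv] := Cq.
(* Below the row of [v], project [q]; above it, [q] would conflict with [v]; on it, [q] itself
   serves. *)
case: (ltngtP (vy q) (vy v)) => qy.
- exists (q.1, v.2); split=> //; last by apply/andP; split; [apply: ltnW|].
  by apply: (proj q) => //; right.
- case: (facet_antidiag_free qF vF); apply/antidiagP; split=> //; split=> // x y ? ?.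
  by apply: B; lia.
- by exists q; split=> //; lia.
Qed.

End ConflictCorner.

Lemma lexlt_gen_step (G : grid) (F H : {set vtx G}) :
  is_facet F -> is_facet H -> lexlt F H ->
  exists2 v, gen_step_lrc F v & v \notin H.
Proof.
move=> Ffacet [Hface _] /lexlt_witness[z [zH zF eq_above]].
have [HV Hn] := Hface.
have below p : p \in F -> ~ antidiag p z.
  move=> pF pz; apply: (Hn p z) => //; rewrite -eq_above //.
  by case/antidiagP: pz => _ [? _]; rewrite /ltV; apply/orP; left.
have exC : exists p, p \in F /\ antidiag z p.
  have [p pF [pz | zp]] := facet_conflict Ffacet (subsetP HV _ zH) zF.
    by case: (below p).
  by exists p.
have [p0 [p0F zp0] right_p0] := ex_argmax (fun p : vtx G => vx p) exC.
have [v [vF zv ev] low_v] := @ex_argmin _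
  (fun p : vtx G => [/\ p \in F, antidiag z p & vx p = vx p0])
  (fun p => vy p) (ex_intro _ p0 (And3 p0F zp0 erefl)).
have v_right p : p \in F -> antidiag z p -> vx p <= vx v.
  by move=> pF zp; rewrite ev; apply: right_p0.
have v_low p : p \in F -> antidiag z p -> vx p = vx v -> vy v <= vy p.
  by move=> pF zp; rewrite ev => ep; apply: low_v.
exists v; last by apply/negP => vH; apply: (Hn z v).
have /antidiagP[zvx [zvy B]] := zv.
have exE := above_corner Ffacet Hface zH eq_above vF zv v_right.
have exA := left_corner Ffacet Hface zH eq_above vF zv v_low.
(* Taking the lowest [E] and the rightmost [A] clears the two sides of the step of other vertices of
   [F]. *)
have [E [EF Ex Ey] E_low] := ex_argmin (fun E : vtx G => vy E) exE.
have [A [AF Ay Ax] A_right] := ex_argmax (fun A : vtx G => vx A) exA.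
exists A, E; split; first by split.
split=> //; split=> //; split; first lia; split; first lia.
split=> [t ty tx|]; first by apply/negP => tF; have := A_right t ltac:(split=> //; lia); lia.
split=> [t tx ty|]; first by apply/negP => tF; have := E_low t ltac:(split=> //; lia); lia.
split; first by exists (vx v).-1; split; [|apply: B]; lia.
split; [lia | split; first lia].
by move=> x y ? ?; apply: B; lia.
Qed.

Theorem theorem3p6 (G : grid) (fs : seq {set vtx G}) :
  grid_ok G ->
  (forall F, is_facet F <-> F \in fs) ->
  (forall i, i.+1 < size fs -> lexlt (nth set0 fs i.+1) (nth set0 fs i)) ->
  (forall j, 1 <= j < size fs ->
     forall K, prefix_cap fs j K <->
       gen (fun H => exists2 v, gen_step_lrc (nth set0 fs j) v &
                                H = nth set0 fs j :\ v) K)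
  /\ is_shelling (@is_facet G) fs.
Proof.
move=> _ fsP /lexlt_nth dec.
have gen_lrc j : 1 <= j < size fs ->
     forall K, prefix_cap fs j K <->
       gen (fun H => exists2 v, gen_step_lrc (nth set0 fs j) v &
                                H = nth set0 fs j :\ v) K.
  move=> /andP[j0 js] K; set F := nth set0 fs j.
  have Ffacet : is_facet F by apply/fsP/mem_nth.
  split=> [[[_ [i ij ->] KH] [_ -> KF]]|[_ [v stepv ->] KFv]].
    have Hfacet : is_facet (nth set0 fs i) by apply/fsP/mem_nth/(ltn_trans ij).
    have [|v stepv vH] := lexlt_gen_step Ffacet Hfacet.
      by apply: dec; rewrite ij.
    exists (F :\ v); first by exists v.
    by rewrite subsetD1 KF; apply: contra vH; apply: (subsetP KH).
  split; last by exists F => //; apply: subset_trans KFv (subsetDl _ _).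
  have [w [wface vw wv]] := gen_step_exchange Ffacet.1 stepv.
  have [H Hfacet wH] := face_in_facet wface.
  have vF : v \in F by case: stepv => [A [E [[]]]].
  have wF : w \notin F by apply/negP => wF; have [[_ Fn] _] := Ffacet; apply: (Fn w v).
  have /fsP/(nthP set0)[i hi eH] := Hfacet.
  exists H; last by apply: subset_trans KFv _; apply: subset_trans wH; apply: subsetUr.
  have wH' : w \in H by apply: (subsetP wH); apply: setU11.
  exists i => //; case: (ltngtP i j) => // ij; last first.
    by rewrite -eH ij -/F in wH'; rewrite wH' in wF.
  (* If [H] came after [F], the largest point where they differ would lie in [F] but not in [H],
     hence be [v]; yet [w] is above [v] and only in [H]. *)
  have /lexlt_witness[z [zF zH eqz]] : lexlt H F.
    by rewrite -eH; apply: dec; rewrite ij.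
  have zv : z = v.
    apply/eqP; apply: contraR zH => zv; apply: (subsetP wH).
    by rewrite !inE zv zF orbT.
  by rewrite -eqz ?zv // wH' in wF.
split=> //; split; [|split=> // j hj].
  apply/(uniqP set0) => i j; rewrite !inE => hi hj eij.
  case: (ltngtP i j) => // ij; [have := dec i j | have := dec j i];
    by rewrite ij ?hi ?hj eij => /(_ isT) /lexlt_irr.
set F := nth set0 fs j.
exists [set H | `[<exists2 v, gen_step_lrc F v & H = F :\ v>]]; split; [|split].
(* The empty face lies in the intersection because [0 < j], so some generator contains it. *)
- have /(gen_lrc j hj)[H [v stepv eH] _] : prefix_cap fs j set0.
    split; last by exists F; rewrite ?sub0set.
    by exists (nth set0 fs 0); rewrite ?sub0set //; exists 0; first lia.
  by apply/set0Pn; exists H; rewrite inE; apply/asboolP; exists v.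
- move=> H; rewrite inE => /asboolP[v stepv ->].
  have vF : v \in F by case: stepv => [A [E [[]]]].
  split; first exact: properD1.
  (* max_proper_face quantifies over arbitrary predicates K, not only over sets *)
  move=> K FK KF; apply: funext => x; change ((x \in K) = (x \in F :\ v)).
  apply/idP/idP; last exact: (subsetP FK).
  move=> xK; rewrite !inE (subsetP (proper_sub KF)) // andbT.
  apply/eqP => xv; rewrite {}xv in xK; case/properP: KF => _ [y yF].
  case: (eqVneq y v) => [->|yv]; first by rewrite xK.
  by rewrite (subsetP FK) // !inE yv.
- move=> K; rewrite gen_lrc //; split=> -[H hH KH]; exists H => //.
    by rewrite inE; apply/asboolP.
  by move: hH; rewrite inE => /asboolP.
Qed.
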